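(* For every positive integer $\ell$, $$\operatorname{Der}\widehat{\mathfrak g}^{\,\Theta}_\ell(2)=\operatorname{Inn}\widehat{\mathfrak g}^{\,\Theta}_\ell(2)\oplus\mathbb C\eta_\Theta\oplus\mathbb C\delta_\Theta .$$
   Context: All algebras are over $\mathbb C$. $\operatorname{Der}$ denotes the derivation algebra and $\operatorname{Inn}$ the inner derivations; $\oplus$ is a direct sum of vector spaces. The exotic central extension $\widehat{\mathfrak g}^{\,\Theta}_\ell(2)$ ($\ell$ a positive integer) is the complex Lie algebra with basis $e,f,h,s,p_0,\dots,p_{2\ell},q_0,\dots,q_{2\ell},z$ and non-zero brackets (up to skew-symmetry) $$[h,e]=2e,\quad [h,f]=-2f,\quad [e,f]=h,$$ $$[h,p_n]=2(\ell-n)p_n,\quad [e,p_n]=np_{n-1},\quad [f,p_n]=(2\ell-n)p_{n+1},$$ $$[h,q_n]=2(\ell-n)q_n,\quad [e,q_n]=nq_{n-1},\quad [f,q_n]=(2\ell-n)q_{n+1},$$ $$[s,p_n]=p_n,\quad [s,q_n]=-q_n,\quad [p_m,q_n]=\delta_{m+n,2\ell}(-1)^m(2\ell-m)!\,m!\,z,$$ where $0\le m,n\le 2\ell$ and $p_{-1}=q_{-1}=p_{2\ell+1}=q_{2\ell+1}=0$. $\eta_\Theta$ is the linear map with $\eta_\Theta(s)=z$ and $\eta_\Theta(x)=0$ for every other basis element $x$. $\delta_\Theta$ is the linear map with $\delta_\Theta(p_n)=p_n$, $\delta_\Theta(q_n)=q_n$, $\delta_\Theta(z)=2z$ and $\delta_\Theta(e)=\delta_\Theta(f)=\delta_\Theta(h)=\delta_\Theta(s)=0$.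 *)

(* Defs.v *)
From HB Require Import structures.
From mathcomp Require Import all_boot all_order all_algebra.
From mathcomp Require Import complex reals.
From mathcomp Require Import ring.

Set Implicit Arguments.
Unset Strict Implicit.
Unset Printing Implicit Defensive.

Import Order.TTheory GRing.Theory Num.Theory.
Local Open Scope ring_scope.

HB.mixin Record isLieAlgebra (K : fieldType) L of Vector K L := {
  lieb : L -> L -> L;
  lieb_linearl : forall y, linear (lieb^~ y);
  lieb_linearr : forall x, linear (lieb x);
  liebxx : forall x, lieb x x = 0;
  lieb_jacobi : forall x y z,
    lieb x (lieb y z) + lieb y (lieb z x) + lieb z (lieb x y) = 0 }.

#[short(type="lieAlgType")]
HB.structure Definition LieAlgebra (K : fieldType) :=
  { L of Vector K L & isLieAlgebra K L }.

Notation "\[ x , y ]" := (lieb x y)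
  (at level 0, x at level 99, y at level 99, format "\[ x ,  y ]") : ring_scope.

Section Derivations.

Variables (K : fieldType) (L : lieAlgType K).

Definition ad (x : L) : 'End(L) := linfun (lieb x).

Lemma adE x y : ad x y = \[x, y].
Proof.
pose H := GRing.isLinear.Build K L L _ (lieb x) (lieb_linearr x).
pose f : {linear L -> L} := HB.pack (lieb x : L -> L) H.
exact: (lfunE f).
Qed.

Fact ad_is_linear : linear ad.
Proof.
move=> a x y; apply/lfunP=> z.
by rewrite add_lfunE scale_lfunE !adE lieb_linearl.
Qed.

HB.instance Definition _ := GRing.isLinear.Build K L 'End(L) _ ad ad_is_linear.

Definition Inn : {vspace 'End(L)} := limg (linfun ad).

Lemma InnP (d : 'End(L)) : reflect (exists x, d = ad x) (d \in Inn).
Proof.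
apply: (iffP memv_imgP) => [[x _ ->]|[x ->]]; exists x; rewrite ?memvf //;
  by rewrite lfunE.
Qed.

(* The Leibniz rule, written as d \o ad x = ad (d x) + ad x \o d for all x, so
   that Der is the kernel of a linear map; DerP gives the usual form. *)
Definition leibniz_at (d : 'End(L)) (x : L) : 'End(L) :=
  (d \o ad x)%VF - (ad (d x) + (ad x \o d)%VF).

Lemma leibniz_atE d x y :
  leibniz_at d x y = d \[x, y] - (\[d x, y] + \[x, d y]).
Proof. by rewrite !(add_lfunE, opp_lfunE, comp_lfunE, adE). Qed.

Fact leibniz_at_is_linear d : linear (leibniz_at d).
Proof.
move=> a x y; apply/lfunP=> z.
rewrite leibniz_atE [RHS]add_lfunE scale_lfunE !leibniz_atE.
rewrite !lieb_linearl !linearP /= !lieb_linearl.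
by rewrite scalerBr scalerDr [X in _ - X]addrACA opprD addrACA.
Qed.

HB.instance Definition _ d :=
  GRing.isLinear.Build K L 'End(L) _ (leibniz_at d) (leibniz_at_is_linear d).

Definition leibniz_defect (d : 'End(L)) : 'Hom(L, 'End(L)) :=
  linfun (leibniz_at d).

Lemma leibniz_defectE d x y :
  leibniz_defect d x y = d \[x, y] - (\[d x, y] + \[x, d y]).
Proof. by rewrite -leibniz_atE [leibniz_defect d x]lfunE. Qed.

Fact leibniz_defect_is_linear : linear leibniz_defect.
Proof.
move=> a d d'; apply/lfunP=> x; apply/lfunP=> y.
rewrite leibniz_defectE [in RHS]add_lfunE [in RHS]scale_lfunE.
rewrite [RHS]add_lfunE [in RHS]scale_lfunE !leibniz_defectE.
rewrite !(add_lfunE, scale_lfunE) !(lieb_linearl, lieb_linearr).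
by rewrite scalerBr scalerDr [X in _ - X]addrACA opprD addrACA.
Qed.

HB.instance Definition _ :=
  GRing.isLinear.Build K 'End(L) 'Hom(L, 'End(L)) _ leibniz_defect
    leibniz_defect_is_linear.

Definition Der : {vspace 'End(L)} := lker (linfun leibniz_defect).

Lemma DerP (d : 'End(L)) :
  reflect (forall x y, d \[x, y] = \[d x, y] + \[x, d y]) (d \in Der).
Proof.
rewrite memv_ker lfunE /=; apply: (iffP eqP) => [d0 x y|dL].
  have : leibniz_defect d x y = 0 by rewrite d0 !zero_lfunE.
  by rewrite leibniz_defectE => /subr0_eq.
apply/lfunP=> x; apply/lfunP=> y.
by rewrite leibniz_defectE !zero_lfunE dL subrr.
Qed.

End Derivations.

Arguments Inn {K} L.
Arguments Der {K} L.

(* The exotic central extension, as the space of coordinate vectors on the basis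
   e, f, h, s, p_0, ..., p_(2l), q_0, ..., q_(2l), z. *)
Section Exotic.

Variables (K : fieldType) (l : nat).

Inductive exotic_index :=
  | iE | iF | iH | iS | iP of 'I_(2 * l).+1 | iQ of 'I_(2 * l).+1 | iZ.

Definition exotic_index_code (i : exotic_index) :
    option (bool * bool) + ('I_(2 * l).+1 + 'I_(2 * l).+1) :=
  match i with
  | iE => inl (Some (true, true))
  | iF => inl (Some (true, false))
  | iH => inl (Some (false, true))
  | iS => inl (Some (false, false))
  | iZ => inl None
  | iP n => inr (inl n)
  | iQ n => inr (inr n)
  end.

Definition exotic_index_decode c : exotic_index :=
  match c with
  | inl (Some (true, true)) => iE
  | inl (Some (true, false)) => iF
  | inl (Some (false, true)) => iH
  | inl (Some (false, false)) => iS
  | inl None => iZ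
  | inr (inl n) => iP n
  | inr (inr n) => iQ n
  end.

Lemma exotic_index_codeK : cancel exotic_index_code exotic_index_decode.
Proof. by case. Qed.

HB.instance Definition _ :=
  Equality.copy exotic_index (can_type exotic_index_codeK).
HB.instance Definition _ :=
  Choice.copy exotic_index (can_type exotic_index_codeK).
HB.instance Definition _ :=
  Countable.copy exotic_index (can_type exotic_index_codeK).
HB.instance Definition _ :=
  Finite.copy exotic_index (can_type exotic_index_codeK).

Definition exotic : Type := {ffun exotic_index -> K^o}.

HB.instance Definition _ := Vector.copy exotic {ffun exotic_index -> K^o}.

Definition bvec (i : exotic_index) : exotic := [ffun j => (j == i)%:R].

(* p_n and q_n for an arbitrary n : nat, with p_n = q_n = 0 for n > 2 l. *)
Definition pvec (n : nat) : exotic := oapp (fun i => bvec (iP i)) 0 (insub n).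
Definition qvec (n : nat) : exotic := oapp (fun i => bvec (iQ i)) 0 (insub n).

Definition pq_coef (m n : nat) : K :=
  if (m + n == 2 * l)%N then (-1) ^+ m * (2 * l - m)`!%:R * m`!%:R else 0.

(* Every non-zero bracket is listed for one order of its arguments only. The
   coefficient n of p_(n-1) vanishes at n = 0, so the value of n.-1 at 0 is
   irrelevant. *)
Definition exotic_table (i j : exotic_index) : exotic :=
  match i, j with
  | iH, iE => 2 *: bvec iE
  | iH, iF => - 2 *: bvec iF
  | iE, iF => bvec iH
  | iH, iP n => (2 * (l%:R - n%:R)) *: pvec n
  | iE, iP n => n%:R *: pvec n.-1
  | iF, iP n => (2 * l%:R - n%:R) *: pvec n.+1
  | iH, iQ n => (2 * (l%:R - n%:R)) *: qvec n
  | iE, iQ n => n%:R *: qvec n.-1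
  | iF, iQ n => (2 * l%:R - n%:R) *: qvec n.+1
  | iS, iP n => pvec n
  | iS, iQ n => - qvec n
  | iP m, iQ n => pq_coef m n *: bvec iZ
  | _, _ => 0
  end.

Definition exotic_bracket (x y : exotic) : exotic :=
  \sum_i \sum_j (x i * y j) *: (exotic_table i j - exotic_table j i).

Local Notation br := exotic_bracket.

Fact br_linearl y : linear (br^~ y).
Proof.
move=> a x x'; rewrite /br scaler_sumr -big_split; apply: eq_bigr => i _ /=.
rewrite scaler_sumr -big_split; apply: eq_bigr => j _ /=.
by rewrite !ffunE scalerA -scalerDl mulrDl mulrA.
Qed.

Fact br_linearr x : linear (br x).
Proof.
move=> a y y'; rewrite /br scaler_sumr -big_split; apply: eq_bigr => i _ /=.
rewrite scaler_sumr -big_split; apply: eq_bigr => j _ /=.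
by rewrite !ffunE scalerA -scalerDl mulrDr mulrCA.
Qed.

Fact brxx x : br x x = 0.
Proof.
rewrite /br.
under eq_bigr do under eq_bigr do rewrite scalerBr.
under eq_bigr do rewrite sumrB.
rewrite sumrB [X in _ - X]exchange_big /=.
under [X in _ - X]eq_bigr do under eq_bigr do rewrite mulrC.
by rewrite subrr.
Qed.

Let eq_from_ffun (x y : exotic) : x =1 y -> x = y.
Proof. by move=> e; apply: (proj1 (@ffunP exotic_index (fun=> K^o) x y)). Qed.

Let coord_sum (I : finType) (F : I -> exotic) j :
  (\sum_i F i) j = \sum_i F i j.
Proof. exact: (sum_ffunE (aT := exotic_index) (rT := K^o)). Qed.

Lemma bvec_sum (x : exotic) : x = \sum_i x i *: bvec i.
Proof.
apply: eq_from_ffun => j; rewrite coord_sum (bigD1 j) //= big1 => [|i ne].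
  by rewrite !ffunE eqxx addr0 /GRing.scale /= mulr1.
by rewrite !ffunE eq_sym (negPf ne) scaler0.
Qed.

Lemma br_bvec i j : br (bvec i) (bvec j) = exotic_table i j - exotic_table j i.
Proof.
rewrite /br (bigD1 i) //= [X in _ + X]big1 ?addr0 => [|k ne]; last first.
  by apply: big1 => k' _; rewrite !ffunE (negPf ne) mul0r scale0r.
rewrite (bigD1 j) //= [X in _ + X]big1 ?addr0 => [|k ne]; last first.
  by rewrite !ffunE (negPf ne) mulr0 scale0r.
by rewrite !ffunE !eqxx mulr1 scale1r.
Qed.

Let brDl x y z : br (x + y) z = br x z + br y z.
Proof. by have := br_linearl z 1 x y; rewrite !scale1r. Qed.
Let brDr x y z : br z (x + y) = br z x + br z y.
Proof. by have := br_linearr z 1 x y; rewrite !scale1r. Qed.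
Let br0l z : br 0 z = 0.
Proof. by apply: (addrI (br 0 z)); rewrite -brDl !addr0. Qed.
Let br0r z : br z 0 = 0.
Proof. by apply: (addrI (br z 0)); rewrite -brDr !addr0. Qed.
Let brZl a x z : br (a *: x) z = a *: br x z.
Proof. by have := br_linearl z a x 0; rewrite br0l !addr0. Qed.
Let brZr a x z : br z (a *: x) = a *: br z x.
Proof. by have := br_linearr z a x 0; rewrite br0r !addr0. Qed.
Let brNl x z : br (- x) z = - br x z.
Proof. by rewrite -scaleN1r brZl scaleN1r. Qed.
Let brNr x z : br z (- x) = - br z x.
Proof. by rewrite -scaleN1r brZr scaleN1r. Qed.

Let brC x y : br x y = - br y x.
Proof.
apply/eqP; rewrite -addr_eq0; apply/eqP.
by have := brxx (x + y); rewrite brDl !brDr !brxx addr0 add0r.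
Qed.

Let v (b : bool) := if b then pvec else qvec.

Let sg (b : bool) : K := if b then 1 else -1.

Let v_out b k : (2 * l < k)%N -> v b k = 0.
Proof.
by case: b => lk; rewrite /v /pvec /qvec insubN // ltnS -ltnNge.
Qed.

Let pvecE (n : 'I_(2 * l).+1) : pvec n = bvec (iP n).
Proof. by rewrite /pvec valK. Qed.
Let qvecE (n : 'I_(2 * l).+1) : qvec n = bvec (iQ n).
Proof. by rewrite /qvec valK. Qed.

Let bE := bvec iE.
Let bF := bvec iF.
Let bH := bvec iH.
Let bS := bvec iS.
Let bZ := bvec iZ.

Let brEv b k : (k <= 2 * l)%N -> br bE (v b k) = k%:R *: v b k.-1.
Proof.
rewrite -ltnS => lk; pose n := Ordinal lk; rewrite -[k]/(n : nat).
by case: b; rewrite /v /bE ?pvecE ?qvecE br_bvec /= subr0.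
Qed.
Let brFv b k : (k <= 2 * l)%N ->
  br bF (v b k) = (2 * l%:R - k%:R) *: v b k.+1.
Proof.
rewrite -ltnS => lk; pose n := Ordinal lk; rewrite -[k]/(n : nat).
by case: b; rewrite /v /bF ?pvecE ?qvecE br_bvec /= subr0.
Qed.
Let brHv b k : br bH (v b k) = (2 * (l%:R - k%:R)) *: v b k.
Proof.
have [lk|lk] := leqP k (2 * l)%N; last by rewrite v_out // br0r scaler0.
move: lk; rewrite -ltnS => lk; pose n := Ordinal lk; rewrite -[k]/(n : nat).
by case: b; rewrite /v /bH ?pvecE ?qvecE br_bvec /= subr0 -?(pvecE n) -?(qvecE n).
Qed.
Let brSv b k : br bS (v b k) = sg b *: v b k.
Proof.
have [lk|lk] := leqP k (2 * l)%N; last by rewrite v_out // br0r scaler0.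
move: lk; rewrite -ltnS => lk; pose n := Ordinal lk; rewrite -[k]/(n : nat).
case: b; rewrite /v /sg /bS ?pvecE ?qvecE br_bvec /= subr0 -?(pvecE n) -?(qvecE n).
  by rewrite scale1r.
by rewrite scaleN1r.
Qed.
Let brvv b m n : br (v b m) (v b n) = 0.
Proof.
have [lm|lm] := leqP m (2 * l)%N; last by rewrite v_out // br0l.
have [ln|ln] := leqP n (2 * l)%N; last by rewrite [v _ n]v_out // br0r.
move: lm ln; rewrite -![(_ <= 2 * l)%N]ltnS => lm ln.
pose i := Ordinal lm; pose j := Ordinal ln.
rewrite -[m]/(i : nat) -[n]/(j : nat).
by case: b; rewrite /v ?pvecE ?qvecE br_bvec /= subr0.
Qed.
Let brpq m n : (m <= 2 * l)%N -> (n <= 2 * l)%N ->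
  br (v true m) (v false n) = pq_coef m n *: bZ.
Proof.
rewrite -![(_ <= 2 * l)%N]ltnS => lm ln.
pose i := Ordinal lm; pose j := Ordinal ln.
rewrite -[m]/(i : nat) -[n]/(j : nat).
by rewrite /v ?pvecE ?qvecE br_bvec /= subr0.
Qed.
Let brZz x : br bZ x = 0.
Proof.
rewrite (bvec_sum x) (big_morph _ (fun x y => brDr x y bZ) (br0r bZ)).
by apply: big1 => i _; rewrite brZr /bZ br_bvec; case: i => * /=; rewrite subr0 scaler0.
Qed.
Let brzZ x : br x bZ = 0.
Proof. by rewrite brC brZz oppr0. Qed.
Let brEF : br bE bF = bH. Proof. by rewrite br_bvec /= subr0. Qed.
Let brHE : br bH bE = 2 *: bE. Proof. by rewrite br_bvec /= subr0. Qed.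
Let brHF : br bH bF = - 2 *: bF. Proof. by rewrite br_bvec /= subr0. Qed.
Let brSE : br bS bE = 0. Proof. by rewrite br_bvec /= subr0. Qed.
Let brSF : br bS bF = 0. Proof. by rewrite br_bvec /= subr0. Qed.
Let brSH : br bS bH = 0. Proof. by rewrite br_bvec /= subr0. Qed.

Let jac x y z := br x (br y z) + br y (br z x) + br z (br x y).

Let jac_rot x y z : jac x y z = jac y z x.
Proof. by rewrite /jac [RHS]addrC addrA. Qed.

Let jac_swap x y z : jac x y z = - jac y x z.
Proof.
rewrite /jac (brC x z) (brC z y) (brC y x) !brNr !opprD !opprK.
by rewrite [X in X + _ = _]addrC.
Qed.

Let jac_bas x y z : (forall i, jac (bvec i) y z = 0) -> jac x y z = 0.
Proof.
move=> J; have Dl u w : jac (u + w) y z = jac u y z + jac w y z.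
  by rewrite /jac !(brDl, brDr) [X in X + _]addrACA [LHS]addrACA.
have Zl a u : jac (a *: u) y z = a *: jac u y z.
  by rewrite /jac !(brZl, brZr) !scalerDr.
rewrite (bvec_sum x).
rewrite (big_morph (fun u => jac u y z) Dl (_ : _ = 0)); last first.
  by rewrite -(scale0r (0 : exotic)) Zl !scale0r.
by apply: big1 => i _; rewrite Zl J scaler0.
Qed.

Let brFE : br bF bE = - bH. Proof. by rewrite brC brEF. Qed.
Let brEH : br bE bH = - 2 *: bE. Proof. by rewrite brC brHE scaleNr. Qed.
Let brFH : br bF bH = 2 *: bF. Proof. by rewrite brC brHF scaleNr opprK. Qed.
Let brES : br bE bS = 0. Proof. by rewrite brC brSE oppr0. Qed.
Let brFS : br bF bS = 0. Proof. by rewrite brC brSF oppr0. Qed.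
Let brHS : br bH bS = 0. Proof. by rewrite brC brSH oppr0. Qed.

Let brgen := (brEF, brHE, brHF, brSE, brSF, brSH, brFE, brEH, brFH, brES, brFS,
  brHS, brxx).
Let brlin := (brZl, brZr, brNl, brNr, br0l, br0r, brZz, brzZ).

Let jacE x y z : jac x y z = br x (br y z) - br y (br x z) - br (br x y) z.
Proof. by rewrite /jac [br z x]brC [br y (- _)]brNr [br z (br x y)]brC. Qed.

Let v_leq b k : (k <= 2 * l)%N \/ v b k = 0.
Proof. by have [lk|lk] := leqP k (2 * l)%N; [left|right; apply: v_out]. Qed.

Let natl2 k : k = (2 * l)%N -> 2 * l%:R - k%:R = 0 :> K.
Proof. by move=> ->; rewrite natrM subrr. Qed.

Let brEFv b k : (k <= 2 * l)%N ->
  br bE (br bF (v b k)) = ((2 * l%:R - k%:R) * k.+1%:R) *: v b k.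
Proof.
move=> lk; rewrite brFv // brZr.
move: lk; rewrite leq_eqVlt => /orP[/eqP e|lk].
  by rewrite natl2 // mul0r !scale0r.
by rewrite brEv // scalerA.
Qed.

Let brFEv b k : (k <= 2 * l)%N ->
  br bF (br bE (v b k)) = (k%:R * (2 * l%:R - k%:R + 1)) *: v b k.
Proof.
case: k => [|k] lk; rewrite brEv // brZr ?mul0r ?scale0r //=.
rewrite brFv ?(ltnW lk) // scalerA -natr1; congr (_ *: _); ring.
Qed.

Let jacEFv b k : jac bE bF (v b k) = 0.
Proof.
case: (v_leq b k) => [lk|->]; last by rewrite jacE !brlin !subrr.
rewrite jacE brEFv // brFEv // brEF brHv -!scalerBl -natr1 -[RHS](scale0r (v b k)).
congr (_ *: _); ring.
Qed.

Let jacHEv b k : jac bH bE (v b k) = 0.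
Proof.
case: (v_leq b k) => [lk|->]; last by rewrite jacE !brlin !subrr.
rewrite jacE brHv brHE !brlin !brEv // !brlin brHv.
case: k lk => [|k] lk; first by rewrite !scale0r !scaler0 !subrr.
rewrite /= !scalerA -!scalerBl -[RHS](scale0r (v b k)) -natr1.
congr (_ *: _); ring.
Qed.

Let jacHFv b k : jac bH bF (v b k) = 0.
Proof.
case: (v_leq b k) => [lk|->]; last by rewrite jacE !brlin !subrr.
rewrite jacE brHv brHF !brlin !brFv // !brlin brHv.
rewrite !scalerA -!scalerBl -[RHS](scale0r (v b k.+1)) -natr1.
congr (_ *: _); ring.
Qed.

Let jacSXv x b k : x \in [:: bE; bF; bH] -> jac bS x (v b k) = 0.
Proof.
case: (v_leq b k) => [lk|->]; last by rewrite jacE !brlin !subrr.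
rewrite !inE => /or3P[]/eqP->; rewrite jacE !brgen !brlin subr0 !brSv brlin;
  rewrite (brEv, brFv, brHv) // !brlin brSv !scalerA mulrC subrr //.
Qed.

Let jacXvv x b m n : x \in [:: bE; bF; bH; bS] -> jac x (v b m) (v b n) = 0.
Proof.
case: (v_leq b m) => [lm|->]; last by rewrite jacE !brlin !subrr.
case: (v_leq b n) => [ln|->]; last by rewrite jacE !brlin !subrr.
by rewrite !inE => /or4P[]/eqP->; rewrite jacE (brEv, brFv, brHv, brSv) //
  (brEv, brFv, brHv, brSv) // !brlin !brvv !brlin !scaler0 !subrr.
Qed.

Let pq_out m n : (m + n != 2 * l)%N -> pq_coef m n = 0.
Proof. by rewrite /pq_coef => /negPf->. Qed.

Let pq_in m n : (m + n)%N = (2 * l)%N -> pq_coef m n = (-1) ^+ m * n`!%:R * m`!%:R.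
Proof. by move=> e; rewrite /pq_coef -e eqxx addKn. Qed.

Let brpq' m n : br (v true m) (v false n) = pq_coef m n *: bZ.
Proof.
have [lm|lm] := leqP m (2 * l)%N; last first.
  rewrite v_out // br0l pq_out ?scale0r // neq_ltn.
  by rewrite (leq_trans lm) ?orbT ?leq_addr.
have [ln|ln] := leqP n (2 * l)%N; last first.
  rewrite [v _ n]v_out // br0r pq_out ?scale0r // neq_ltn.
  by rewrite (leq_trans ln) ?orbT ?leq_addl.
exact: brpq.
Qed.

Let coefSS m n : (m + n).+1 = (2 * l)%N ->
  n.+1%:R * pq_coef m.+1 n + m.+1%:R * pq_coef m n.+1 = 0.
Proof.
move=> e; rewrite !pq_in ?addnS // !factS exprS !natrM; ring.
Qed.

Let coefE m n : (m <= 2 * l)%N -> (n <= 2 * l)%N ->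
  n%:R * pq_coef m n.-1 + m%:R * pq_coef m.-1 n = 0.
Proof.
case: m => [|m]; case: n => [|n] //= lm ln.
- by rewrite !mul0r addr0.
- by rewrite mul0r addr0 pq_out ?mulr0 // add0n ltn_eqF.
- by rewrite mul0r add0r pq_out ?mulr0 // addn0 ltn_eqF.
have [/coefSS //|ne] := eqVneq (m + n).+1 (2 * l)%N.
by rewrite !pq_out ?addnS // !mulr0 addr0.
Qed.

Let coefF m n : (m <= 2 * l)%N -> (n <= 2 * l)%N ->
  (2 * l%:R - n%:R) * pq_coef m n.+1 + (2 * l%:R - m%:R) * pq_coef m.+1 n = 0.
Proof.
move=> lm ln; have [e|ne] := eqVneq (m + n).+1 (2 * l)%N; last first.
  by rewrite !pq_out ?addnS // !mulr0 addr0.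
have -> : 2 * l%:R - n%:R = m.+1%:R :> K.
  by rewrite -natrM -e -addSn natrD addrK.
have -> : 2 * l%:R - m%:R = n.+1%:R :> K.
  by rewrite -natrM -e -addnS natrD addrC addKr.
by rewrite addrC coefSS.
Qed.

Let coefH m n : (2 * (l%:R - n%:R) + 2 * (l%:R - m%:R)) * pq_coef m n = 0.
Proof.
have [e|ne] := eqVneq (m + n)%N (2 * l)%N; last by rewrite pq_out ?mulr0.
rewrite (_ : _ + _ = 2 * (2 * l%:R - (m%:R + n%:R))); last by ring.
by rewrite -natrD e natrM subrr mulr0 mul0r.
Qed.

Let jacXpq x m n :
  x \in [:: bE; bF; bH; bS] -> jac x (v true m) (v false n) = 0.
Proof.
case: (v_leq true m) => [lm|->]; last by rewrite jacE !brlin !subrr.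
case: (v_leq false n) => [ln|->]; last by rewrite jacE !brlin !subrr.
rewrite !inE => /or4P[]/eqP->; rewrite jacE brpq' brlin brzZ scaler0 sub0r.
- rewrite !brEv // !brlin !brpq' !scalerA -opprD -scalerDl.
  by rewrite coefE // scale0r oppr0.
- rewrite !brFv // !brlin !brpq' !scalerA -opprD -scalerDl.
  by rewrite coefF // scale0r oppr0.
- by rewrite !brHv !brlin !brpq' !scalerA -opprD -scalerDl -mulrDl coefH scale0r oppr0.
by rewrite !brSv !brlin !brpq' !scalerA -opprD -scalerDl /sg mulN1r mul1r addNr scale0r
  oppr0.
Qed.

Let brvvv b b' c m n k : br (v c k) (br (v b m) (v b' n)) = 0.
Proof.
have pq i j : br (v c k) (br (v true i) (v false j)) = 0.
  by rewrite brpq' brlin brzZ scaler0.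
case: b; case: b'; rewrite ?brvv ?br0r //.
by rewrite [X in br _ X]brC brNr pq oppr0.
Qed.

Let jacvvv b b' c m n k : jac (v b m) (v b' n) (v c k) = 0.
Proof. by rewrite /jac !brvvv !addr0. Qed.

Let jacZ x y : jac x y bZ = 0.
Proof. by rewrite jacE !(brzZ, br0r) !subrr. Qed.

Let jacxx x y : jac x x y = 0.
Proof. by rewrite jacE subrr brxx br0l subr0. Qed.

Let rk i : nat :=
  match i with
  | iE => 0 | iF => 1 | iH => 2 | iS => 3 | iP _ => 4 | iQ _ => 5 | iZ => 6
  end.

Let jac_sorted i j k : (rk i <= rk j)%N -> (rk j <= rk k)%N ->
  jac (bvec i) (bvec j) (bvec k) = 0.
Proof.
have hX : [/\ bE \in [:: bE; bF; bH], bF \in [:: bE; bF; bH]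
   & bH \in [:: bE; bF; bH]] by rewrite !inE !eqxx !orbT.
have hY : [/\ bE \in [:: bE; bF; bH; bS], bF \in [:: bE; bF; bH; bS],
   bH \in [:: bE; bF; bH; bS] & bS \in [:: bE; bF; bH; bS]].
  by rewrite !inE !eqxx !orbT.
case: hX hY => hE hF hH [hE' hF' hH' hS'].
have EFH : jac bE bF bH = 0.
  by rewrite jacE !(brgen, brlin) !scalerN !scaleNr !opprK subr0 subrr.
have XYS x y : x \in [:: bE; bF; bH] -> y \in [:: bE; bF; bH] -> jac x y bS = 0.
  by rewrite !inE => /or3P[]/eqP-> /or3P[]/eqP->; rewrite jacE !(brgen, brlin) /=
    ?(scaler0, oppr0, subr0).
have YXv x y b n : x \in [:: bE; bF; bH] -> y \in [:: bE; bF; bH] ->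
    jac x y (v b n) = 0.
  have sw u w : jac u w (v b n) = 0 -> jac w u (v b n) = 0.
    by move=> e; rewrite jac_swap e oppr0.
  rewrite !inE => /or3P[]/eqP-> /or3P[]/eqP->.
  - exact: jacxx.
  - exact: jacEFv.
  - exact/sw/jacHEv.
  - exact/sw/jacEFv.
  - exact: jacxx.
  - exact/sw/jacHFv.
  - exact: jacHEv.
  - exact: jacHFv.
  exact: jacxx.
have XSv x b n : x \in [:: bE; bF; bH] -> jac x bS (v b n) = 0.
  by move=> hx; rewrite jac_swap jacSXv ?oppr0.
have xyy x y : jac x y y = 0 by rewrite jac_rot jac_rot jac_rot jac_rot jacxx.
have X w : (rk w <= 2)%N -> bvec w \in [:: bE; bF; bH] by case: w.
have Y w : (rk w <= 3)%N -> bvec w \in [:: bE; bF; bH; bS] by case: w.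
have V w : (4 <= rk w <= 5)%N -> exists n, bvec w = v (rk w == 4%N) n.
  by case: w => [||||n|n|] // _; exists n; rewrite ?(pvecE, qvecE).
pose J a b c := jac (bvec a) (bvec b) (bvec c) = 0.
have J1 a b : J a b iZ by exact: jacZ.
have J2 a b : J a a b by exact: jacxx.
have J3 a b : J a b b by exact: xyy.
have J4 : J iE iF iH by exact: EFH.
have J5 a b : (rk a <= 2)%N -> (rk b <= 2)%N -> J a b iS.
  by move=> /X ? /X ?; exact: XYS.
have J6 a b c : (rk a <= 2)%N -> (rk b <= 2)%N -> (4 <= rk c <= 5)%N -> J a b c.
  by move=> /X ? /X ? /V[n e]; rewrite /J e; exact: YXv.
have J7 a c : (rk a <= 2)%N -> (4 <= rk c <= 5)%N -> J a iS c.
  by move=> /X ? /V[n e]; rewrite /J e; exact: XSv.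
have J8 a b c : (rk a <= 3)%N -> (4 <= rk b <= 5)%N -> (4 <= rk c <= 5)%N ->
    (rk b <= rk c)%N -> J a b c.
  move=> /Y ? Vb Vc bc; have [[n eb] [m ec]] := (V b Vb, V c Vc).
  rewrite /J eb ec; have [eq|ne] := eqVneq (rk b) (rk c).
    by rewrite eq; exact: jacXvv.
  have [-> ->] : rk b = 4%N /\ rk c = 5%N.
    by case: (b) (c) Vb Vc bc ne {eb ec} => [||||?|?|] [||||?|?|].
  exact: jacXpq.
have J9 a b c : (4 <= rk a <= 5)%N -> (4 <= rk b <= 5)%N ->
    (4 <= rk c <= 5)%N -> J a b c.
  by move=> /V[n1 e1] /V[n2 e2] /V[n3 e3]; rewrite /J e1 e2 e3; exact: jacvvv.
rewrite -/(J i j k); clearbody J.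
case: i => [||||m|m|]; case: j => [||||n|n|] // ; case: k => [||||k|k|] // _ _;
  first [ by apply: J1 | by apply: J2 | by apply: J3 | by apply: J4 | by apply: J5 | by apply: J6
     | by apply: J7 | by apply: J8 | by apply: J9 ].
Qed.

Fact br_jacobi x y z : jac x y z = 0.
Proof.
move: x y z; suff J i j k : jac (bvec i) (bvec j) (bvec k) = 0.
  move=> x y z; apply: jac_bas => i; rewrite jac_rot.
  by apply: jac_bas => j; rewrite jac_rot; apply: jac_bas => k; rewrite jac_rot.
have ij a b c : (rk a <= rk b)%N ->
    jac (bvec a) (bvec b) (bvec c) = 0.
  move=> ab; have [bc|/ltnW cb] := leqP (rk b) (rk c); first exact: jac_sorted.
  have [ac|/ltnW ca] := leqP (rk a) (rk c).
    by rewrite jac_swap jac_rot jac_sorted ?oppr0.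
  by rewrite -jac_rot jac_sorted.
have [/ij//|/ltnW ji] := leqP (rk i) (rk j).
by rewrite jac_swap ij ?oppr0.
Qed.

HB.instance Definition _ :=
  isLieAlgebra.Build K exotic br_linearl br_linearr brxx br_jacobi.

Definition linext (g : exotic_index -> exotic) : 'End(exotic) :=
  linfun (fun x : exotic => \sum_i x i *: g i).

Lemma linextE g i : linext g (bvec i) = g i.
Proof.
pose F (x : exotic) : exotic := \sum_i x i *: g i.
have Flin : linear F.
  move=> a x y; rewrite /F scaler_sumr -big_split; apply: eq_bigr => j _ /=.
  by rewrite !ffunE scalerDl scalerA.
pose f : {linear exotic -> exotic} :=
  HB.pack F (GRing.isLinear.Build K exotic exotic _ F Flin).
rewrite [LHS](lfunE f) /= /F (bigD1 i) //= big1 => [|j ne].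
  by rewrite !ffunE eqxx scale1r addr0.
by rewrite !ffunE (negPf ne) scale0r.
Qed.

Definition eta_Theta : 'End(exotic) :=
  linext (fun i => if i is iS then bvec iZ else 0).

Definition delta_Theta : 'End(exotic) :=
  linext (fun i => match i with
                   | iP n => bvec (iP n)
                   | iQ n => bvec (iQ n)
                   | iZ => 2 *: bvec iZ
                   | _ => 0
                   end).

End Exotic.

(* Main.v *)
(* The element t = 2h + s acts diagonally on the given basis, with integer
   weights that are distinct except that h, s and z have weight 0. Modulo an
   inner derivation, a derivation d sends t into <h, s, z>; comparing the two
   sides of the Leibniz rule for [t, b] on each basis vector b then forces d t to
   be a multiple of z and every b of nonzero weight to be an eigenvector of d.
   The eigenvalues on p_n and q_n are propagated from n = 0 by f, so that d is
   determined by d e, d s, d p_0 and d q_0: these four parameters are accounted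
   for by ad h, eta, ad s and delta. *)
Require Import Defs.
From mathcomp Require Import all_boot all_order all_algebra.
From mathcomp Require Import complex reals.
From mathcomp Require Import ring zify.
Import GRing.Theory.
Local Open Scope ring_scope.

(** * Derivations of an arbitrary Lie algebra *)

Section LieAlgebra.

Context {K : fieldType} {L : lieAlgType K}.
Implicit Types (x y z : L) (d : 'End(L)).

Lemma liebZl a x y : \[a *: x, y] = a *: \[x, y].
Proof. by rewrite -!adE linearZ scale_lfunE. Qed.

Lemma liebDl x y z : \[x + y, z] = \[x, z] + \[y, z].
Proof. by rewrite -!adE linearD add_lfunE. Qed.

Lemma liebZr a x y : \[x, a *: y] = a *: \[x, y].
Proof. by rewrite -!adE linearZ. Qed.

Lemma liebC x y : \[x, y] = - \[y, x].
Proof.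
apply/eqP; rewrite -addr_eq0; apply/eqP; have := liebxx (x + y).
by rewrite liebDl -(adE x) -(adE y) !linearD /= !adE !liebxx add0r addr0.
Qed.

Lemma ad_Der x : ad x \in Der L.
Proof.
apply/DerP => y z; rewrite !adE; have /eqP := lieb_jacobi x y z.
rewrite (liebC z x) (liebC z \[x, y]) -!(adE y) linearN /= adE.
by rewrite -addrA addr_eq0 opprD !opprK addrC => /eqP.
Qed.

Lemma Inn_sub_Der : (Inn L <= Der L)%VS.
Proof. by apply/subvP => _ /InnP[x ->]; apply: ad_Der. Qed.

(** If [f] and [w n] are eigenvectors of a derivation, so is their bracket, with the sum of the
    eigenvalues; [c n != 0] then passes this on to [w n.+1]. *)
Lemma Der_ladder d f (a b : K) (c : nat -> K) (w : nat -> L) N :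
  d \in Der L -> d f = b *: f -> d (w 0%N) = a *: w 0%N ->
  (forall n, (n < N)%N -> \[f, w n] = c n *: w n.+1 /\ c n != 0) ->
  forall n, (n <= N)%N -> d (w n) = (a + n%:R * b) *: w n.
Proof.
move=> /DerP dD df dw fw; elim=> [_|n IH lt_nN]; first by rewrite mul0r addr0.
have [fwn cn0] := fw n lt_nN; apply: (scalerI cn0).
rewrite -linearZ /= -fwn dD df IH ?(ltnW lt_nN) //= liebZl liebZr fwn -scalerDl.
by rewrite !scalerA -natr1; congr (_ *: _); ring.
Qed.

End LieAlgebra.

Lemma capv_line_eq0 (K : fieldType) (V : vectType K) (U : {vspace V}) (v : V) :
  v \notin U -> (U :&: <[v]> == 0)%VS.
Proof.
move=> vU; rewrite -subv0; apply/subvP=> x /memv_capP[xU /vlineP[a xE]].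
rewrite memv0; move: xU; rewrite xE; have [->|a0] := eqVneq a 0.
  by rewrite scale0r.
by move/(memvZ a^-1); rewrite scalerA mulVf // scale1r (negPf vU).
Qed.

(** * Endomorphisms in coordinates *)

Section Exotic.

Context {K : fieldType} {l : nat}.

Local Notation L := (exotic K l).
Local Notation I := (exotic_index l).
Local Notation bvec := (@bvec K l).
Implicit Types (i j : I) (d : 'End(L)).

Lemma exoticP (x y : L) : x =1 y -> x = y.
Proof. by move=> e; apply: (proj1 (@ffunP I (fun=> K^o) x y)). Qed.

Lemma exotic_sumE (F : I -> L) j : (\sum_i F i) j = \sum_i F i j.
Proof. exact: (sum_ffunE (aT := I) (rT := K^o)). Qed.

Lemma lfun_bvec_sum (d : 'End(L)) x : d x = \sum_i x i *: d (bvec i).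
Proof.
by rewrite {1}(bvec_sum x) linear_sum; apply: eq_bigr => i _; rewrite linearZ.
Qed.

Lemma lfun_bvecP d d' : (forall i, d (bvec i) = d' (bvec i)) -> d = d'.
Proof.
move=> e; apply/lfunP=> x; rewrite !lfun_bvec_sum.
by apply: eq_bigr => i _; rewrite e.
Qed.

Lemma lfun_diagE d (c : I -> K) : (forall i, d (bvec i) = c i *: bvec i) ->
  forall x i, d x i = c i * x i.
Proof.
move=> dE x i; rewrite lfun_bvec_sum exotic_sumE (bigD1 i) //= big1 => [|j ne].
  by rewrite dE !ffunE eqxx addr0 /GRing.scale /= mulr1 mulrC.
by rewrite dE !ffunE eq_sym (negPf ne) !scaler0.
Qed.

Lemma lieb_bvec i j :
  \[bvec i, bvec j] = exotic_table K i j - exotic_table K j i.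
Proof. exact: br_bvec. Qed.

Lemma pvecE (n : 'I_(2 * l).+1) : pvec K l n = bvec (iP n).
Proof. by rewrite /pvec valK. Qed.

Lemma qvecE (n : 'I_(2 * l).+1) : qvec K l n = bvec (iQ n).
Proof. by rewrite /qvec valK. Qed.

Lemma bvec_Der d : (forall i j, d \[bvec i, bvec j] =
    \[d (bvec i), bvec j] + \[bvec i, d (bvec j)]) -> d \in Der L.
Proof.
move=> dD; rewrite memv_ker lfunE /=; apply/eqP; apply/lfunP => x.
rewrite zero_lfunE (bvec_sum x) linear_sum big1 // => i _; rewrite linearZ /=.
suff -> : leibniz_defect d (bvec i) = 0 by rewrite scaler0.
by apply: lfun_bvecP => j; rewrite leibniz_defectE dD subrr zero_lfunE.
Qed.

(** * Weights of the basis under h, s and t *)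

Definition hweight i : int :=
  match i with
  | iE => 2 | iF => - 2
  | iP n | iQ n => 2 * (l%:Z - n%:Z)
  | _ => 0
  end.

Definition sweight i : int :=
  match i with iP _ => 1 | iQ _ => - 1 | _ => 0 end.

(** Integer values let [lia] compare weights; [intr_char0_eq0] carries the results over to [K]. *)
Definition weight i : int := 2 * hweight i + sweight i.

Lemma lieb_h i : \[bvec (iH l), bvec i] = (hweight i)%:~R *: bvec i.
Proof.
rewrite lieb_bvec; case: i => [||||n|n|] /=;
  rewrite ?(subr0, subrr, scale0r) -?pvecE -?qvecE //;
  by congr (_ *: _); rewrite ?rmorphM ?rmorphB ?rmorphN /=.
Qed.

Lemma lieb_s i : \[bvec (iS l), bvec i] = (sweight i)%:~R *: bvec i.
Proof.
by rewrite lieb_bvec; case: i => [||||n|n|] /=;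
  rewrite ?(subr0, subrr, scale0r, scale1r, scaleN1r) -?pvecE -?qvecE.
Qed.

Lemma lieb_z i : \[bvec (iZ l), bvec i] = 0.
Proof. by rewrite lieb_bvec; case: i => [||||n|n|] /=; rewrite subrr. Qed.

Lemma lieb_zr x : \[x, bvec (iZ l)] = 0.
Proof.
rewrite liebC -adE lfun_bvec_sum big1 ?oppr0 // => i _.
by rewrite adE lieb_z scaler0.
Qed.

(* The coefficient 2 makes ad t separate all the root spaces other than the
   centralizer <h, s, z> of t. *)
Definition grading_elt : L := 2 *: bvec (iH l) + bvec (iS l).
Local Notation t := grading_elt.

Lemma lieb_t i : \[t, bvec i] = (weight i)%:~R *: bvec i.
Proof.
rewrite liebDl liebZl lieb_h lieb_s scalerA -scalerDl.
by rewrite /weight rmorphD rmorphM.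
Qed.

Lemma lieb_tE x i : \[t, x] i = (weight i)%:~R * x i.
Proof. rewrite -adE (lfun_diagE _ (fun i => (weight i)%:~R)) // => j.
by rewrite adE lieb_t. Qed.

(** Residues mod 4 separate the families: e and f have weights 4 and -4, p_n has 4(l-n)+1 and q_n
    has 4(l-n)-1. *)
Lemma weight_inj i j : weight i = weight j -> weight i != 0 -> i = j.
Proof.
case: i => [||||n|n|]; case: j => [||||m|m|]; rewrite /weight /= => e w0 //; try lia;
  by congr (_ _); apply: val_inj => /=; lia.
Qed.

Lemma weight0 i : weight i = 0 -> [\/ i = iH l, i = iS l | i = iZ l].
Proof.
by case: i => [||||n|n|]; rewrite /weight /= => w0;
  try lia; [constructor 1|constructor 2|constructor 3].
Qed.

(** * The outer derivations delta and eta *)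

Definition degree i : nat :=
  match i with iP _ | iQ _ => 1 | iZ => 2 | _ => 0 end.

Lemma delta_bvec i : delta_Theta K l (bvec i) = (degree i)%:R *: bvec i.
Proof. by rewrite linextE; case: i => *; rewrite ?scale0r ?scale1r. Qed.

Lemma eta_bvec i : eta_Theta K l (bvec i) = (i == iS l)%:R *: bvec (iZ l).
Proof. by rewrite linextE; case: i => *; rewrite ?scale0r ?scale1r. Qed.

Lemma delta_pvec n : delta_Theta K l (pvec K l n) = pvec K l n.
Proof.
by rewrite /pvec; case: insub => [i|] /=; rewrite ?linear0 ?delta_bvec ?scale1r.
Qed.

Lemma delta_qvec n : delta_Theta K l (qvec K l n) = qvec K l n.
Proof.
by rewrite /qvec; case: insub => [i|] /=; rewrite ?linear0 ?delta_bvec ?scale1r.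
Qed.

Lemma eta_pvec n : eta_Theta K l (pvec K l n) = 0.
Proof.
by rewrite /pvec; case: insub => [i|] /=; rewrite ?linear0 ?eta_bvec ?scale0r.
Qed.

Lemma eta_qvec n : eta_Theta K l (qvec K l n) = 0.
Proof.
by rewrite /qvec; case: insub => [i|] /=; rewrite ?linear0 ?eta_bvec ?scale0r.
Qed.

(** The bracket is graded by [degree], since [p_m, q_n] is a multiple of z, of degree 1 + 1; delta
    multiplies each homogeneous vector by its degree. *)
Lemma delta_Der : delta_Theta K l \in Der L.
Proof.
apply: bvec_Der => i j.
have T i' j' : delta_Theta K l (exotic_table K i' j')
    = (degree i' + degree j')%:R *: exotic_table K i' j'.
  by case: i' => [||||n|n|]; case: j' => [||||m|m|] /=;
    rewrite ?linear0 ?linearZ ?linearN /= ?delta_pvec ?delta_qvec ?delta_bvec /=;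
    rewrite ?scale0r ?scaler0 ?scale1r // scalerA scalerA mulrC.
rewrite !delta_bvec liebZl liebZr -scalerDl lieb_bvec linearB /= !T.
by rewrite [(degree j + _)%N]addnC -scalerBr natrD.
Qed.

(** Both sides of the Leibniz rule vanish: s occurs in no bracket, so eta kills all of them, and its
    values lie on the central line of z. *)
Lemma eta_Der : eta_Theta K l \in Der L.
Proof.
apply: bvec_Der => i j.
have T i' j' : eta_Theta K l (exotic_table K i' j') = 0.
  by case: i' => [||||n|n|]; case: j' => [||||m|m|] /=;
    rewrite ?linear0 ?linearZ ?linearN /= ?eta_pvec ?eta_qvec ?eta_bvec /=;
    rewrite ?scale0r ?scaler0 ?oppr0.
rewrite !eta_bvec liebZl liebZr lieb_bvec linearB /= !T subr0.
by rewrite lieb_zr lieb_z !scaler0 addr0.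
Qed.

(** * Normal form of a derivation in characteristic zero *)

Hypothesis charK0 : [pchar K] =i pred0.

Lemma intr_char0_eq0 (m : int) : (m%:~R == 0 :> K) = (m == 0).
Proof.
by case: m => n; rewrite ?NegzE ?rmorphN ?oppr_eq0 /= -pmulrn ((pcharf0P K).1 charK0).
Qed.

Lemma natr_char0_eq0 (n : nat) : (n%:R == 0 :> K) = (n == 0%N).
Proof. exact: (pcharf0P K).1. Qed.

(* The image of ad t is spanned by the vectors of nonzero weight. *)
Lemma Der_mod_Inn_grading d :
  exists x, forall i, weight i != 0 -> (d - ad x) t i = 0.
Proof.
(* The sign comes from [x, t] = - [t, x]. At weight 0 the quotient is 0 by convention, and nothing
   is claimed there. *)
exists [ffun i => - (d t i / (weight i)%:~R)] => i wi.
rewrite add_lfunE opp_lfunE adE liebC opprK.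
rewrite [LHS]ffunE lieb_tE ffunE mulrN mulrC divfK ?subrr //.
by rewrite intr_char0_eq0.
Qed.

Lemma Der_diagonal d : d \in Der L -> (0 < l)%N ->
  (forall i, weight i != 0 -> d t i = 0) ->
  d t = d t (iZ l) *: bvec (iZ l) /\
  (forall i, weight i != 0 -> d (bvec i) = d (bvec i) i *: bvec i).
Proof.
move=> /DerP dD l0 dt0.
have dtE : d t = d t (iH l) *: bvec (iH l) + d t (iS l) *: bvec (iS l)
    + d t (iZ l) *: bvec (iZ l).
  apply: exoticP => i; rewrite !ffunE.
  have [/weight0[]->|wi] := eqVneq (weight i) 0;
    rewrite ?eqxx /= /GRing.scale /= ?(mulr0, mulr1, addr0, add0r) // dt0 //.
  case: i wi => [||||n|n|] //= _; by rewrite !(mulr0, addr0).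
set a := d t (iH l) in dtE; set b := d t (iS l) in dtE.
(* Coordinate j of the Leibniz rule for [t, b_i]; the z-part of d t is central and drops out. *)
have dtb i j : (weight i)%:~R * d (bvec i) j =
    (a * (hweight i)%:~R + b * (sweight i)%:~R) * (j == i)%:R
    + (weight j)%:~R * d (bvec i) j.
  rewrite -lieb_tE.
  have := dD t (bvec i); rewrite lieb_t linearZ /= {1}dtE !liebDl !liebZl.
  rewrite lieb_h lieb_s lieb_z scaler0 addr0 !scalerA -scalerDl.
  by move/(congr1 (fun x : L => x j)); rewrite !ffunE.
(* For j = i the two weight terms cancel. Then e yields 2a = 0, and p_0 yields b = 0. *)
have lam0 i : a * (hweight i)%:~R + b * (sweight i)%:~R = 0.
  by have := dtb i i; rewrite eqxx mulr1 -[LHS]add0r => /addIr <-.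
have a0 : a = 0.
  have := lam0 (iE l); rewrite /= mulr0 addr0 => /eqP.
  by rewrite mulf_eq0 natr_char0_eq0 orbF => /eqP.
have b0 : b = 0.
  by have := lam0 (iP ord0); rewrite a0 /= mul0r add0r mulr1.
split; first by rewrite {1}dtE a0 b0 !scale0r !add0r.
move=> i wi; apply: exoticP => j; rewrite !ffunE /GRing.scale /=.
have [->|ne] := eqVneq j i; first by rewrite mulr1.
(* Off the diagonal, (w_i - w_j) d(b_i)_j = 0, where w_i is nonzero and hence differs from w_j. *)
have := dtb i j; rewrite lam0 mul0r add0r mulr0 => /eqP.
rewrite -subr_eq0 -mulrBl -rmorphB mulf_eq0 intr_char0_eq0 subr_eq0.
by case/orP=> [/eqP/weight_inj/(_ wi) e|/eqP//]; rewrite e eqxx in ne.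
Qed.

Lemma Der_grading_normal d : d \in Der L -> (0 < l)%N ->
  (forall i, weight i != 0 -> d t i = 0) ->
  exists x a b, d = ad x + a *: eta_Theta K l + b *: delta_Theta K l.
Proof.
move=> dDer l0 /(Der_diagonal _ dDer l0)[]; set c := d t _ => dt dw.
have /DerP dD := dDer.
pose E := bvec (iE l); pose F := bvec (iF l); pose H := bvec (iH l).
pose S := bvec (iS l); pose Z := bvec (iZ l).
have two0 : 2 != 0 :> K by rewrite natr_char0_eq0.
have := dw (iE l) isT; set a := d _ _; rewrite -/E => dE.
have := dw (iF l) isT; set b := d _ _; rewrite -/F => dF.
have EF : \[E, F] = H by rewrite lieb_bvec subr0.
have HE : \[H, E] = 2 *: E by rewrite lieb_h.
have E0 : E != 0.
  apply/eqP => /(congr1 (fun x : L => x (iE l))) /eqP.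
  by rewrite !ffunE eqxx oner_eq0.
have dHab : d H = (a + b) *: H.
  by rewrite -EF dD dE dF liebZl liebZr -scalerDl.
(* Applying d to [h, e] = 2e gives 2a = 2(a + b) + 2a. *)
have ba : b = - a.
  apply/eqP; rewrite -addr_eq0 addrC.
  have := dD H E; rewrite dHab HE dE linearZ /= dE liebZl liebZr HE !scalerA.
  rewrite [2 * a]mulrC -[LHS]add0r => /addIr/esym/eqP.
  by rewrite scaler_eq0 (negPf E0) orbF mulf_eq0 (negPf two0) orbF addrC.
have dH : d H = 0 by rewrite dHab ba subrr scale0r.
(* Since t = 2h + s and d h = 0, d s equals d t. *)
have dS : d S = c *: Z by rewrite -dt /t linearD linearZ /= dH scaler0 add0r.
have lad n : (n < 2 * l)%N -> 2 * l%:R - n%:R != 0 :> K.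
  by move=> ln; rewrite -natrM -natrB ?(ltnW ln) // natr_char0_eq0 subn_eq0 -ltnNge.
have wP n : weight (iP n) != 0 by rewrite /weight /=; lia.
have wQ n : weight (iQ n) != 0 by rewrite /weight /=; lia.
have := dw _ (wP ord0); set p := d _ _; rewrite -pvecE /= => dp0.
have := dw _ (wQ ord0); set q := d _ _; rewrite -qvecE /= => dq0.
have dP n : (n <= 2 * l)%N -> d (pvec K l n) = (p + n%:R * b) *: pvec K l n.
  apply: (Der_ladder d F p b (fun n => 2 * l%:R - n%:R)) => // k lk.
  split; last exact: lad.
  have lk' : (k < (2 * l).+1)%N by apply: ltnW.
  by rewrite -[k]/(nat_of_ord (Ordinal lk')) pvecE lieb_bvec subr0.
have dQ n : (n <= 2 * l)%N -> d (qvec K l n) = (q + n%:R * b) *: qvec K l n.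
  apply: (Der_ladder d F q b (fun n => 2 * l%:R - n%:R)) => // k lk.
  split; last exact: lad.
  have lk' : (k < (2 * l).+1)%N by apply: ltnW.
  by rewrite -[k]/(nat_of_ord (Ordinal lk')) qvecE lieb_bvec subr0.
(* The vector z has weight 0, so its eigenvalue is read off from [p_0, q_(2l)] = (2l)! z, a nonzero
   multiple of z. *)
have dZ : d Z = (p + q + (2 * l)%:R * b) *: Z.
  have PQ : \[pvec K l 0, qvec K l (2 * l)] = (2 * l)`!%:R *: Z.
    have -> : pvec K l 0 = bvec (iP ord0) by rewrite -pvecE.
    have -> : qvec K l (2 * l) = bvec (iQ ord_max) by rewrite -qvecE.
    by rewrite lieb_bvec subr0 /= /pq_coef add0n eqxx subn0 mul1r mulr1.
  have f0 : (2 * l)`!%:R != 0 :> K by rewrite natr_char0_eq0 -lt0n fact_gt0.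
  apply: (scalerI f0); rewrite -linearZ /= -PQ dD dP // dQ //= liebZl liebZr.
  by rewrite PQ -scalerDl !scalerA; congr (_ *: _); ring.
(* The eigenvalue 2 of ad h on e fixes the coefficient a/2 of h, and d s = c z fixes that of eta.
   With u and v the coefficients of s and delta, p_0 and q_0 require a l + u + v = p and a l - u + v
   = q. *)
exists ((a / 2) *: H + ((p - q) / 2) *: S), c, ((p + q) / 2 - a * l%:R).
apply: lfun_bvecP => i.
rewrite !add_lfunE !scale_lfunE adE liebDl !liebZl lieb_h lieb_s delta_bvec eta_bvec.
case: i => [||||n|n|]; rewrite /= ?(scale0r, scaler0, addr0, add0r) //.
- by rewrite dE scalerA divfK.
- by rewrite dF ba scalerA; congr (_ *: _); field.
- by rewrite scale1r.
- rewrite -pvecE dP -1?ltnS // !scalerA -!scalerDl rmorphM rmorphB /= ba.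
  by congr (_ *: _); rewrite -!pmulrn; field.
- rewrite -qvecE dQ -1?ltnS // !scalerA -!scalerDl rmorphM rmorphB /= ba.
  by congr (_ *: _); rewrite -!pmulrn; field.
by rewrite dZ ba natrM !scalerA; congr (_ *: _); field.
Qed.

(** * The decomposition and its directness *)

Lemma exotic_Der : (0 < l)%N ->
  Der L = (Inn L + <[eta_Theta K l]> + <[delta_Theta K l]>)%VS.
Proof.
move=> l0; apply/eqP; rewrite eqEsubv !subv_add Inn_sub_Der -!memvE eta_Der delta_Der.
rewrite !andbT; apply/subvP => d dDer.
have [x dx] := Der_mod_Inn_grading d.
have dxDer : d - ad x \in Der L by rewrite memvB ?ad_Der.
have [y [a [b e]]] := Der_grading_normal _ dxDer l0 dx.
rewrite -(subrK (ad x) d) e addrC !addrA.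
by rewrite !memv_add ?memvZ ?memv_line // memvD //; apply/InnP; eexists.
Qed.

(** Evaluation at s shows that eta is not inner: [x, s] has no z-coordinate, as ad s is diagonal and
    kills z, whereas eta s = z. Evaluation at z separates delta from the rest: inner derivations and
    eta kill z, whereas delta z = 2z. *)
Lemma exotic_directv :
  directv (Inn L + <[eta_Theta K l]> + <[delta_Theta K l]>)%VS.
Proof.
rewrite !directv_addE /= !directv_trivial /=; apply/andP; split.
  apply: capv_line_eq0; apply/InnP => -[x].
  move/(congr1 (fun d : 'End(L) => d (bvec (iS l)) (iZ l))) => /eqP.
  rewrite eta_bvec adE liebC -adE !ffunE.
  rewrite (lfun_diagE _ (fun i => (sweight i)%:~R)) => [|i]; last first.
    by rewrite adE lieb_s.
  by rewrite !eqxx mul0r oppr0 scale1r oner_eq0.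
apply: capv_line_eq0; apply/negP => /memv_addP[_ /InnP[x ->]] [_ /vlineP[a ->]].
move/(congr1 (fun d : 'End(L) => d (bvec (iZ l)) (iZ l))) => /eqP.
rewrite delta_bvec add_lfunE scale_lfunE adE lieb_zr eta_bvec /= scale0r scaler0.
by rewrite addr0 !ffunE eqxx /GRing.scale /= mulr1 natr_char0_eq0.
Qed.

End Exotic.

Theorem theorem3p6 (R : realType) (l : nat) (hl : (0 < l)%N) :
  Der (exotic R[i] l) =
    (Inn (exotic R[i] l) + <[eta_Theta R[i] l]> + <[delta_Theta R[i] l]>)%VS
  /\ directv (Inn (exotic R[i] l) + <[eta_Theta R[i] l]>
              + <[delta_Theta R[i] l]>)%VS.
Proof.
have char0 := Num.Theory.pchar_num R[i].
by split; [apply: exotic_Der|apply: exotic_directv].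
Qed.
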